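(* Let $B$ be a normal band that is $Y$-basic or pliant. Then $\operatorname{IG}(B)$ is abundant.
   Context: A band is a semigroup all of whose elements are idempotent. A band $B$ is normal if it satisfies $xyzx=xzyx$; equivalently, $B=\mathcal{B}(Y;B_\alpha,\phi_{\alpha,\beta})$ is a strong semilattice of rectangular bands: $B$ is the disjoint union of rectangular bands $B_\alpha$ indexed by a semilattice $Y$ (ordered by $\alpha\leq\beta$ iff $\alpha\beta=\alpha$), with morphisms $\phi_{\alpha,\beta}:B_\alpha\to B_\beta$ for $\alpha\geq\beta$ (written on the right) such that $\phi_{\alpha,\alpha}=1_{B_\alpha}$, $\phi_{\alpha,\beta}\phi_{\beta,\gamma}=\phi_{\alpha,\gamma}$ for $\alpha\geq\beta\geq\gamma$, and $xy=(x\phi_{\alpha,\alpha\beta})(y\phi_{\beta,\alpha\beta})$ for $x\in B_\alpha$, $y\in B_\beta$. $B$ is $Y$-basic if each $B_\alpha$ is either a left zero band or a right zero band. $B$ is pliant if for every $\alpha\in Y$ there exists $a_\alpha\in B_\alpha$ such that for all $\beta>\alpha$ and $u\in B_\beta$, $u\phi_{\beta,\alpha}=a_\alpha$. A pair $(e,f)\in B\times B$ is basic if $\{e,f\}\cap\{ef,fe\}\neq\emptyset$. The free idempotent generated semigroup over $B$ is given by the presentation $\operatorname{IG}(B)=\langle \overline{B} : \overline{e}\,\overline{f}=\overline{ef},\ (e,f)\text{ a basic pair}\rangle$ (as a semigroup), where $\overline{B}=\{\overline{e}:e\in B\}$ is a set of symbols in bijection with $B$. For a semigroup $S$: $a\,\mathcal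 L^*\,b$ iff for all $x,y\in S^1$, $ax=ay\Leftrightarrow bx=by$; $a\,\mathcal R^*\,b$ iff for all $x,y\in S^1$, $xa=ya\Leftrightarrow xb=yb$. $S$ is abundant if each $\mathcal L^*$-class and each $\mathcal R^*$-class contains an idempotent. *)

(* Defs.v *)
From HB Require Import structures.
From mathcomp Require Import all_boot all_order.
From mathcomp Require Import boolp.

Set Implicit Arguments.
Unset Strict Implicit.
Unset Printing Implicit Defensive.

Import Algebra.

Local Open Scope group_scope.
Local Open Scope order_scope.
Local Open Scope quotient_scope.

(** * Bands *)

Definition band (B : semigroupType) : Prop := forall x : B, x * x = x.

Definition normal_band (B : semigroupType) : Prop :=
  band B /\ forall x y z : B, x * y * z * x = x * z * y * x.

Definition rectangular_band_on (S : semigroupType) (A : S -> Prop) : Prop :=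
  [/\ forall x y, A x -> A y -> A (x * y),
      forall x, A x -> x * x = x
    & forall x y, A x -> A y -> x * y * x = x].

Definition left_zero_on (S : semigroupType) (A : S -> Prop) : Prop :=
  forall x y, A x -> A y -> x * y = x.

Definition right_zero_on (S : semigroupType) (A : S -> Prop) : Prop :=
  forall x y, A x -> A y -> x * y = y.

(** [strong_semilattice B Y] is a presentation of [B] as a strong semilattice
    of rectangular bands over [Y]. The disjoint union is encoded by the map
    [ss_index : B -> Y], the component [B_ a] being its fibre over [a]. The
    connecting morphism from [B_ a] to [B_ b] is [ss_map a b], a total function
    on [B] about which nothing is said unless [b <= a] and its argument is in
    [B_ a]. In a meet semilattice, [a <= b] iff [a `&` b = a]. *)
Record strong_semilattice (B : semigroupType) (d : Order.disp_t)
    (Y : meetSemilatticeType d) := StrongSemilattice {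
  ss_index : B -> Y;
  ss_map : Y -> Y -> B -> B;
  ss_component (a : Y) : B -> Prop := fun x => ss_index x = a;
  ss_nonempty : forall a : Y, exists x : B, ss_component a x;
  ss_rectangular : forall a : Y, rectangular_band_on (ss_component a);
  ss_map_component : forall (a b : Y) (x : B), b <= a ->
    ss_component a x -> ss_component b (ss_map a b x);
  ss_map_morphism : forall (a b : Y) (x y : B), b <= a ->
    ss_component a x -> ss_component a y ->
    ss_map a b (x * y) = ss_map a b x * ss_map a b y;
  ss_map_id : forall (a : Y) (x : B), ss_component a x -> ss_map a a x = x;
  ss_map_comp : forall (a b c : Y) (x : B), b <= a -> c <= b ->
    ss_component a x -> ss_map b c (ss_map a b x) = ss_map a c x;
  ss_mul : forall (a b : Y) (x y : B), ss_component a x -> ss_component b y ->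
    x * y = ss_map a (a `&` b) x * ss_map b (a `&` b) y
}.

(** Such a decomposition is unique up to isomorphism of [Y] (the components
    are the D-classes of [B], and for [x] in [B_ a] and [b <= a] the image of
    [x] in [B_ b] is [x * y * x] for any [y] in [B_ b]), so asking for some
    decomposition with a property is the same as asking it of all of them. *)
Definition Y_basic (B : semigroupType) : Prop :=
  exists (d : Order.disp_t) (Y : meetSemilatticeType d)
         (D : strong_semilattice B Y),
  forall a : Y, left_zero_on (ss_component D a) \/
                right_zero_on (ss_component D a).

Definition pliant (B : semigroupType) : Prop :=
  exists (d : Order.disp_t) (Y : meetSemilatticeType d)
         (D : strong_semilattice B Y),
  forall a : Y, exists2 x : B, ss_component D a x &
    forall (b : Y) (u : B), a < b -> ss_component D b u -> ss_map D b a u = x.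

(** * Semigroup presentations *)

Record free_semigroup (X : Type) := FreeSemigroup {
  word :> seq X;
  word_nonempty : ~~ nilp word
}.

HB.instance Definition _ (X : Type) := [isSub for @word X].
HB.instance Definition _ (X : choiceType) := [Choice of free_semigroup X by <:].

Lemma free_mul_subproof (X : Type) (u v : free_semigroup X) : ~~ nilp (u ++ v).
Proof. by case: u => -[]. Qed.

Definition free_mul (X : Type) (u v : free_semigroup X) : free_semigroup X :=
  FreeSemigroup (free_mul_subproof u v).

Lemma free_mulA (X : choiceType) : associative (@free_mul X).
Proof. by move=> u v w; apply/val_inj/catA. Qed.

HB.instance Definition _ (X : choiceType) :=
  isSemigroup.Build (free_semigroup X) (@free_mulA X).

Definition letter (X : Type) (x : X) : free_semigroup X :=
  @FreeSemigroup X [:: x] isT.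

Inductive congruence_closure (S : semigroupType) (R : S -> S -> Prop) :
    S -> S -> Prop :=
| cc_base x y : R x y -> congruence_closure R x y
| cc_refl x : congruence_closure R x x
| cc_sym x y : congruence_closure R x y -> congruence_closure R y x
| cc_trans x y z : congruence_closure R x y -> congruence_closure R y z ->
    congruence_closure R x z
| cc_mul x x' y y' : congruence_closure R x x' -> congruence_closure R y y' ->
    congruence_closure R (x * y) (x' * y').

Definition congruence_rel (S : semigroupType) (R : S -> S -> Prop) : rel S :=
  fun x y => `[< congruence_closure R x y >].

Lemma congruence_rel_refl (S : semigroupType) (R : S -> S -> Prop) :
  reflexive (congruence_rel R).
Proof. by move=> x; apply/asboolP/cc_refl. Qed.

Lemma congruence_rel_sym (S : semigroupType) (R : S -> S -> Prop) :
  symmetric (congruence_rel R).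
Proof. by move=> x y; apply/asboolP/asboolP; apply: cc_sym. Qed.

Lemma congruence_rel_trans (S : semigroupType) (R : S -> S -> Prop) :
  transitive (congruence_rel R).
Proof.
by move=> y x z /asboolP xy /asboolP yz; apply/asboolP; apply: cc_trans xy yz.
Qed.

Canonical congruence_equiv (S : semigroupType) (R : S -> S -> Prop) :=
  EquivRel (congruence_rel R) (congruence_rel_refl R) (congruence_rel_sym R)
    (@congruence_rel_trans S R).

Definition quotient_semigroup (S : semigroupType) (R : S -> S -> Prop) : Type :=
  {eq_quot congruence_rel R}.

HB.instance Definition _ (S : semigroupType) (R : S -> S -> Prop) :=
  Choice.on (quotient_semigroup R).
HB.instance Definition _ (S : semigroupType) (R : S -> S -> Prop) :=
  Quotient.on (quotient_semigroup R).

Lemma quotient_piP (S : semigroupType) (R : S -> S -> Prop) (x y : S) :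
  \pi_(quotient_semigroup R) x = \pi_(quotient_semigroup R) y <->
  congruence_closure R x y.
Proof. by split=> [/eqquotP/asboolP | xy] //; apply/eqquotP/asboolP. Qed.

Definition quotient_mul (S : semigroupType) (R : S -> S -> Prop)
    (a b : quotient_semigroup R) : quotient_semigroup R :=
  \pi_(quotient_semigroup R) (repr a * repr b).

Lemma quotient_mulE (S : semigroupType) (R : S -> S -> Prop) (x y : S) :
  quotient_mul (\pi_(quotient_semigroup R) x) (\pi_(quotient_semigroup R) y) =
  \pi_(quotient_semigroup R) (x * y).
Proof. by apply/quotient_piP/cc_mul; apply/quotient_piP; rewrite reprK. Qed.

Lemma quotient_mulA (S : semigroupType) (R : S -> S -> Prop) :
  associative (@quotient_mul S R).
Proof.
move=> a b c; rewrite -[a]reprK -[b]reprK -[c]reprK.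
move: (repr a) (repr b) (repr c) => x y z.
by rewrite (quotient_mulE R y z) (quotient_mulE R x (y * z))
  (quotient_mulE R x y) (quotient_mulE R (x * y) z) mulgA.
Qed.

HB.instance Definition _ (S : semigroupType) (R : S -> S -> Prop) :=
  isSemigroup.Build (quotient_semigroup R) (@quotient_mulA S R).

(** * Free idempotent generated semigroups *)

Definition basic_pair (S : semigroupType) (e f : S) : Prop :=
  exists2 x : S, x = e \/ x = f & x = e * f \/ x = f * e.

Definition IG_relation (B : semigroupType) (u v : free_semigroup B) : Prop :=
  exists e f : B,
    [/\ basic_pair e f, u = letter e * letter f & v = letter (e * f)].

Definition IG (B : semigroupType) : semigroupType :=
  quotient_semigroup (@IG_relation B).

(** * Abundance *)

(** Multiplication by an element of [S^1], [None] being the adjoined identity.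
    Adjoining an identity even when [S] already has one does not affect the
    relations below, since both identities then act on [S] in the same way. *)
Definition mul1r (S : semigroupType) (a : S) (x : option S) : S :=
  if x is Some s then a * s else a.

Definition mul1l (S : semigroupType) (x : option S) (a : S) : S :=
  if x is Some s then s * a else a.

Definition Lstar (S : semigroupType) (a b : S) : Prop :=
  forall x y : option S, mul1r a x = mul1r a y <-> mul1r b x = mul1r b y.

Definition Rstar (S : semigroupType) (a b : S) : Prop :=
  forall x y : option S, mul1l x a = mul1l y a <-> mul1l x b = mul1l y b.

Definition abundant (S : semigroupType) : Prop :=
  forall a : S, (exists2 e : S, e * e = e & Lstar a e) /\
                (exists2 e : S, e * e = e & Rstar a e).

(* Main.v *)
(** Write [idx : B -> Y] for the projection onto the semilattice of components,
    and [e] also for the letter of IG(B) given by [e]. For any [s] in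
    IG(B) there is a letter [e] such that [s e = s] and such that [s x = s y]
    implies [e x = e y], whence [s] is L*-related to the idempotent [e].
    By induction on the length of [s], this amounts to cancelling [e] from
    [e f x = e f y]. If [e] and [f] lie in the same component, multiply by
    [f e] on the left. If [idx e <= idx f] does not hold, let IG(B) act on the
    right by deleting the longest prefix of letters of index at least [idx e].
    This is well defined up to identifying [h v] with [v] when [h] lies above
    [v], and the identification is undone by multiplying on the left by a
    letter [c r] of the component [r] where the word starts: in the Y-basic and
    pliant cases [c r] can be chosen with [c r h v = c r v] whenever [h] lies
    above [r] and [v] in [r]. The R* half is the same statement for the
    opposite band. *)

Require Import Defs.
From mathcomp Require Import all_boot all_order.
From HB Require Import structures.
From mathcomp Require Import boolp.

Set Implicit Arguments.
Unset Strict Implicit.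
Unset Printing Implicit Defensive.

Import Algebra Order.Theory.

Local Open Scope group_scope.
Local Open Scope order_scope.
Local Open Scope quotient_scope.

(** * Opposites and the universal property of IG(B) *)

Definition opposite (S : Type) : Type := S.

HB.instance Definition _ (S : semigroupType) := Choice.on (opposite S).

Lemma opposite_mulA (S : semigroupType) :
  associative (fun x y : opposite S => (y : S) * (x : S)).
Proof. by move=> x y z /=; rewrite mulgA. Qed.

HB.instance Definition _ (S : semigroupType) :=
  isSemigroup.Build (opposite S) (@opposite_mulA S).

(** [S] is the free idempotent generated semigroup over [B], described by its
    universal property so as to be invariant under passing to opposites. *)
Definition free_ig (B S : semigroupType) (iota : B -> S) : Prop :=
  [/\ forall e f, basic_pair e f -> iota e * iota f = iota (e * f),
      forall P : S -> Prop, (forall e, P (iota e)) ->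
        (forall s t, P s -> P t -> P (s * t)) -> forall s, P s
    & forall (T : Type) (m : T -> T -> T) (j : B -> T), associative m ->
        (forall e f, basic_pair e f -> m (j e) (j f) = j (e * f)) ->
        exists F : S -> T, (forall e, F (iota e) = j e) /\
          forall s t, F (s * t) = m (F s) (F t)].

Section FreeIG.
Variables (B S : semigroupType) (iota : B -> S).
Hypothesis IGS : free_ig iota.

Lemma iotaM e f : basic_pair e f -> iota e * iota f = iota (e * f).
Proof. by case: IGS => h _ _; apply: h. Qed.

Lemma free_ig_ind_right (P : S -> Prop) :
  (forall e, P (iota e)) -> (forall s e, P s -> P (s * iota e)) ->
  forall s, P s.
Proof.
case: IGS => _ gen _ P1 PM s.
suff [] : P s /\ forall t, P t -> P (t * s) by [].
elim/gen: s => [e | s t [Ps sP] [_ tP]]; first by split=> // t; apply: PM.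
by split=> [|u Pu]; [apply: tP | rewrite mulgA; apply/tP/sP].
Qed.

(** Universal property applied to the self-maps of [X], with composition reversed because letters
    act on the right. *)
Lemma free_ig_action (X : Type) (act : X -> B -> X) :
  (forall x e f, basic_pair e f -> act (act x e) f = act x (e * f)) ->
  exists F : X -> S -> X, (forall x e, F x (iota e) = act x e) /\
    forall x s t, F x (s * t) = F (F x s) t.
Proof.
case: IGS => _ _ univ actM.
have [//|e f ef|F [F1 FM]] := univ (X -> X) (fun g h x => h (g x)) (fun e x => act x e).
  by apply: funext => x; apply: actM.
by exists (fun x s => F s x); split=> [x e | x s t]; rewrite ?F1 ?FM.
Qed.

End FreeIG.

Lemma free_ig_opposite (B S : semigroupType) (iota : B -> S) :
  free_ig iota -> @free_ig (opposite B) (opposite S) iota.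
Proof.
have op_basic (e f : B) : @basic_pair (opposite B) e f -> basic_pair f e.
  by case=> x xe xef; exists x => //; case: xe; tauto.
case=> rel gen univ; split=> [e f /op_basic/rel //|P P1 PM|T m j mA jM].
  by apply: gen => // s t Ps Pt; apply: PM.
have [|e f ef|F [F1 FM]] := univ T (fun x y => m y x) j.
- by move=> x y z; rewrite mA.
- apply: jM; case: ef => x xe xef; exists x => //; case: xe; tauto.
- by exists F; split=> // s t; apply: FM.
Qed.

Lemma mul1rM (S : semigroupType) (s t : S) x : mul1r (s * t) x = s * mul1r t x.
Proof. by case: x => //= u; rewrite mulgA. Qed.

(** * Normal bands over a semilattice *)

Section NormalBand.
Variables (B : semigroupType) (d : Order.disp_t) (Y : meetSemilatticeType d).
Variable idx : B -> Y.
Hypothesis mulxx : band B.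
Hypothesis idxM : forall x y, idx (x * y) = idx x `&` idx y.
Hypothesis idx_rect : forall x y, idx x = idx y -> x * y * x = x.
Hypothesis normal : forall x y z : B, x * y * z * x = x * z * y * x.

Lemma idx_sandwich x y : idx y <= idx x -> idx (x * y * x) = idx y.
Proof. by move=> yx; rewrite !idxM (meet_r yx) (meet_l yx). Qed.

(** Since [y = y z y], normality gives [x y x = x y z x], which by normality again is symmetric in
    [y] and [z]. *)
Lemma sandwich_eq x y z : idx y = idx z -> x * y * x = x * z * x.
Proof.
have shrink u v : idx u = idx v -> x * u * x = x * u * v * x.
  move=> uv; rewrite -{1}(idx_rect uv) [x * (_ * u)]mulgA (normal x (u * v)).
  by rewrite [x * u * _]mulgA -[x * u * u]mulgA mulxx.
by move=> yz; rewrite (shrink y z) // normal -shrink.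
Qed.

Lemma basic_comparable (e f : B) :
  basic_pair e f -> (idx e <= idx f) \/ (idx f <= idx e).
Proof.
case=> x [] -> [] /(congr1 idx); rewrite idxM => h;
  [left|left|right|right]; rewrite h ?leIl ?leIr //.
Qed.

Lemma basic_same e f : idx e = idx f -> basic_pair (f * e) e /\ basic_pair (f * e) f.
Proof.
by move=> ef; split; [exists (f * e)|exists f]; auto;
  left; rewrite -?mulgA ?mulxx // mulgA idx_rect.
Qed.

(** * Relations between products of two letters *)

Section FreeIGOverBand.
Variables (S : semigroupType) (iota : B -> S).
Hypothesis IGS : free_ig iota.

Lemma iota_idem e : iota e * iota e = iota e.
Proof. by rewrite (iotaM IGS) ?mulxx //; exists e; rewrite ?mulxx; auto. Qed.

(** Inside one component, the letter [f * e] undoes left multiplication by [e]. *)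
Lemma iota_cancel e f :
  idx e = idx f -> iota (f * e) * (iota e * iota f) = iota f.
Proof.
move=> ef; have [b1 b2] := basic_same ef.
by rewrite mulgA (iotaM IGS b1) -mulgA mulxx (iotaM IGS b2) idx_rect.
Qed.

(** With [u = h q h], the letter [q] splits as [q u] followed by [q], and [h] merges with [q u] into
    [h q u = u]. *)
Lemma iota_mul_above h q :
  idx q <= idx h -> iota h * iota q = iota (h * q * h) * iota q.
Proof.
move=> qh; set u := h * q * h.
have quq : q * u * q = q by apply: idx_rect; rewrite idx_sandwich.
have quh : q * u * h = q * u by rewrite /u -!mulgA mulxx.
have hqu : h * (q * u) = u by rewrite /u !mulgA -[h * q * h * q]mulgA mulxx.
have {1}<- : iota (q * u) * iota q = iota q.
  by rewrite (iotaM IGS) ?quq //; exists q; rewrite ?quq; auto.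
by rewrite mulgA [iota h * _](iotaM IGS) ?hqu //; exists (q * u); rewrite ?quh; auto.
Qed.

Lemma iota_mul_below h q :
  idx q <= idx h -> iota q * iota h = iota q * iota (h * q * h).
Proof.
move=> qh; set u := h * q * h.
have quq : q * (u * q) = q.
  by rewrite mulgA; apply: idx_rect; rewrite idx_sandwich.
have huq : h * (u * q) = u * q by rewrite /u !mulgA mulxx.
have uqh : u * q * h = u by rewrite /u -mulgA -[h * q * h]mulgA -mulgA
  [h * (q * h)]mulgA -[h * q * h]mulgA mulxx.
have {1}<- : iota q * iota (u * q) = iota q.
  by rewrite (iotaM IGS) ?quq //; exists q; rewrite ?quq; auto.
by rewrite -mulgA [_ * iota h](iotaM IGS) ?uqh //; exists (u * q); auto.
Qed.

(** The state [(r, m)] reached by a word records the meet [m] of its letters and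
    the first index [r] of its normal form over the semilattice, which is the
    index of the last letter lying below all the letters before it. *)
Definition head_step (x : option (Y * Y)) (e : B) : option (Y * Y) :=
  if x is Some (r, m) then
    Some (if idx e <= m then idx e else r, m `&` idx e)
  else Some (idx e, idx e).

(** [head_step] respects basic pairs because their indices are comparable; [None] is the state
    before any letter. *)
Lemma head_exists : exists head : S -> option (Y * Y),
  (forall e, head (iota e) = Some (idx e, idx e)) /\
  forall s e, head (s * iota e) = head_step (head s) e.
Proof.
have [|F [F1 FM]] := free_ig_action IGS (act := head_step); last first.
  by exists (F None); split=> [e | s e]; rewrite ?FM F1.
move=> x e f /basic_comparable ef; case: x => [[r m]|] /=; rewrite idxM.
  congr (Some (_, _)); last by rewrite meetA.
  rewrite !lexI; case: ef => [/[dup] ef /meet_l -> | /[dup] fe /meet_r ->].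
    case: ifP => // /andP[fm fe]; have fE : idx f = idx e by apply/le_anti/andP.
    by rewrite -fE fm.
  rewrite fe andbT; case: ifP => // /negbT fm; rewrite ifN //.
  by apply: contra fm; apply: le_trans.
case: ef => [/[dup] ef /meet_l -> | /[dup] fe /meet_r ->]; last by rewrite fe.
by case: ifP => // fe; rewrite (@le_anti _ _ (idx f) (idx e)) ?fe ?ef.
Qed.

(** * First index of a word and deletion of prefixes *)

Section Head.
Variable head : S -> option (Y * Y).
Hypothesis head1 : forall e, head (iota e) = Some (idx e, idx e).
Hypothesis headM : forall s e, head (s * iota e) = head_step (head s) e.

Lemma headP s : exists r m, [/\ head s = Some (r, m), m <= r,
  exists2 q, idx q = r & iota q * s = s &
  forall g, idx g <= m ->
    exists2 q, idx q = idx g & iota q * (s * iota g) = s * iota g].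
Proof.
elim/(free_ig_ind_right IGS): s => [e | s h [r [m [hs mr sr sm]]]].
  exists (idx e), (idx e); split=> //; first by exists e; rewrite ?iota_idem.
  move=> g ge; exists (e * g * e); first exact: idx_sandwich.
  by rewrite iota_mul_above // mulgA iota_idem.
have sm' g : idx g <= m `&` idx h ->
    exists2 q, idx q = idx g & iota q * (s * iota h * iota g) = s * iota h * iota g.
  rewrite lexI => /andP[gm gh]; have hgh := idx_sandwich gh.
  have [|q qg qs] := sm (h * g * h); first by rewrite hgh.
  exists q; first by rewrite qg.
  by rewrite -(mulgA s) iota_mul_above // (mulgA s) mulgA qs.
rewrite headM hs /=; case: ifP => hm.
  by exists (idx h), (m `&` idx h); split; rewrite ?leIr //; apply: sm.
exists r, (m `&` idx h); split=> //; first by rewrite leIxl.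
by case: sr => q qr qs; exists q; rewrite // mulgA qs.
Qed.

Variable c : Y -> B.
Hypothesis idx_c : forall r, idx (c r) = r.
Hypothesis cP : forall r h v, r < idx h -> idx v = r ->
  iota (c r) * iota h * iota v = iota (c r) * iota v.

Definition head_eq (s t : S) : Prop :=
  exists r m, [/\ head s = Some (r, m), head t = Some (r, m)
    & iota (c r) * s = iota (c r) * t].

Lemma head_eq_refl s : head_eq s s.
Proof. by have [r [m [hs _ _ _]]] := headP s; exists r, m. Qed.

Lemma head_eq_sym s t : head_eq s t -> head_eq t s.
Proof. by case=> r [m [hs ht st]]; exists r, m. Qed.

Lemma head_eq_trans s t u : head_eq s t -> head_eq t u -> head_eq s u.
Proof.
case=> r [m [hs ht st]] [r' [m' []]]; rewrite ht => -[<- <-] hu tu.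
by exists r, m; rewrite st.
Qed.

Lemma head_eq_mulr s t g : head_eq s t -> head_eq (s * iota g) (t * iota g).
Proof.
case=> r [m [hs ht st]]; rewrite /head_eq !headM hs ht /=.
exists (if idx g <= m then idx g else r), (m `&` idx g); split=> //.
case: ifP => gm; last by rewrite !mulgA st.
have [gr|gr] := eqVneq (idx g) r; first by rewrite gr !mulgA st.
(* The first index drops from [r] to [idx g], and [u * iota g] now absorbs a letter [q] of index
   [idx g] on the left; so [cP] allows inserting [c r], which lies above [q]. *)
have absorb u : head u = Some (r, m) ->
    iota (c (idx g)) * (u * iota g) =
    iota (c (idx g)) * (iota (c r) * (u * iota g)).
  move=> hu; have [r' [m' []]] := headP u; rewrite hu => -[<- <-] mr _ um.
  have [q qg <-] := um g gm.
  by rewrite !mulgA cP // idx_c lt_neqAle gr (le_trans gm mr).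
by rewrite (absorb s) // (absorb t) // !(mulgA (iota (c r))) st.
Qed.

Lemma head_eq_drop h v : idx v < idx h -> head_eq (iota h * iota v) (iota v).
Proof.
move=> vh; exists (idx v), (idx v); rewrite headM !head1 /= (ltW vh).
by split=> //; [rewrite (meet_r (ltW vh)) | rewrite mulgA cP].
Qed.

(** Deletion of the longest prefix of letters of index at least [a]: the state
    is [None] as long as only such letters were read, and then the [head_eq]
    class of what follows. *)
Definition tail_step (a : Y) (x : option (S -> Prop)) (g : B) :
    option (S -> Prop) :=
  if x is Some P then
    Some (fun t => exists2 s, P s & head_eq (s * iota g) t)
  else if a <= idx g then None else Some (head_eq (iota g)).

Lemma tail_step_class a s g :
  tail_step a (Some (head_eq s)) g = Some (head_eq (s * iota g)).
Proof.
congr Some; apply/predeqP => t; split=> [[u su ut]|st].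
  exact: head_eq_trans (head_eq_mulr g su) ut.
by exists s => //; apply: head_eq_refl.
Qed.

Lemma tail_stepM a x e f : basic_pair e f ->
  tail_step a (tail_step a x e) f = tail_step a x (e * f).
Proof.
move=> ef; case: x => [P|].
  congr Some; apply/predeqP => t; split=> [[u [s Ps su] ut]|[s Ps st]].
    exists s => //; rewrite -(iotaM IGS ef) mulgA.
    exact: head_eq_trans (head_eq_mulr f su) ut.
  exists (s * iota e); first by exists s => //; apply: head_eq_refl.
  by rewrite -mulgA (iotaM IGS ef).
rewrite {2 3}/tail_step idxM lexI -(iotaM IGS ef).
case: ifP => [ae|/negbT ae]; last by rewrite tail_step_class.
rewrite /=; case: ifP => // /negbT af; congr Some.
(* The delicate case: [e] is deleted but [f] is not, so [f] and [e f] must have the same class. *)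
have fe : idx f < idx e.
  have [ef'|fe] := basic_comparable ef; first by rewrite (le_trans ae ef') in af.
  rewrite lt_neqAle fe andbT; apply: contraNneq af => ->.
  exact: ae.
have drop := head_eq_drop fe.
apply/predeqP => t; split; apply: head_eq_trans; first exact: drop.
exact: head_eq_sym.
Qed.

(** * Left cancellation of letters *)

Lemma iota_drop e f x y : ~~ (idx e <= idx f) ->
  mul1r (iota e * iota f) x = mul1r (iota e * iota f) y ->
  head_eq (mul1r (iota f) x) (mul1r (iota f) y).
Proof.
move=> ef xy; have [F [F1 FM]] := free_ig_action IGS (@tail_stepM (idx e)).
have FS s : forall t, F (Some (head_eq s)) t = Some (head_eq (s * t)).
  move=> t; elim/(free_ig_ind_right IGS): t => [g | t g IH].
    by rewrite F1 tail_step_class.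
  by rewrite FM IH F1 tail_step_class mulgA.
(* With threshold [idx e], exactly the letter [e] is deleted. *)
have FN z : F None (mul1r (iota e * iota f) z) = Some (head_eq (mul1r (iota f) z)).
  have Fef : F None (iota e * iota f) = Some (head_eq (iota f)).
    by rewrite FM !F1 /= lexx /= (negbTE ef).
  by case: z => [s|] //=; rewrite FM Fef FS.
have := FN x; rewrite xy FN => -[<-]; exact: head_eq_refl.
Qed.

Lemma head_le f s r m : head (iota f * s) = Some (r, m) -> r <= idx f.
Proof.
elim/(free_ig_ind_right IGS): s r m => [g | s g IH] r m.
  by rewrite headM head1 => -[<- _]; case: ifP.
rewrite mulgA headM; have [r' [m' [hs mr _ _]]] := headP (iota f * s).
rewrite hs => -[<- _]; have rf := IH _ _ hs.
by case: ifP => // gm; rewrite (le_trans gm) // (le_trans mr).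
Qed.

(** The fixing letter is taken as [f q f] because, by [sandwich_eq], it depends only on [f] and
    [r]. *)
Lemma head_fix f x : exists r m q, [/\ head (mul1r (iota f) x) = Some (r, m),
  idx q = r, r <= idx f & iota (f * q * f) * mul1r (iota f) x = mul1r (iota f) x].
Proof.
set z := mul1r _ _; have [r [m [hz _ [q qr qz] _]]] := headP z.
have fz : iota f * z = z by rewrite /z -mul1rM iota_idem.
have rf : r <= idx f.
  move: hz; rewrite /z; case: (x) => [s /head_le //|/=].
  by rewrite head1 => -[<-].
exists r, m, q; split=> //.
by rewrite -{1}qz mulgA -iota_mul_above ?qr // -mulgA qz.
Qed.

Lemma letter_cancel e f x y : ~~ (idx e <= idx f) ->
  mul1r (iota e * iota f) x = mul1r (iota e * iota f) y ->
  mul1r (iota f) x = mul1r (iota f) y.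
Proof.
move=> ef /(iota_drop ef)[r [m [hx hy cxy]]].
have [r' [m' [q []]]] := head_fix f x; rewrite hx => -[<- _] qr rf qx.
have [r1 [m1 [p []]]] := head_fix f y; rewrite hy => -[<- _] pr _ py.
have pq : f * p * f = f * q * f by apply: sandwich_eq; rewrite pr.
rewrite pq in py; set u := f * q * f in qx py.
have cu : idx (c r) = idx u by rewrite idx_c /u idx_sandwich qr.
(* Both sides are fixed by the same letter [u] of index [r], so multiplication by [c r] can be
   undone. *)
have cancel s : iota u * s = s -> iota (u * c r) * (iota (c r) * s) = s.
  by move=> us; rewrite -us !(mulgA _ _ s) iota_cancel.
by rewrite -(cancel _ qx) cxy cancel.
Qed.

Lemma last_letter s : exists e, s * iota e = s /\
  forall x y, mul1r s x = mul1r s y -> mul1r (iota e) x = mul1r (iota e) y.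
Proof.
elim/(free_ig_ind_right IGS): s => [e | s g [e [se eP]]].
  by exists e; rewrite iota_idem.
have eP' u x y : mul1r (s * iota u) x = mul1r (s * iota u) y ->
    mul1r (iota e * iota u) x = mul1r (iota e * iota u) y.
  by rewrite !mul1rM => /(eP (Some _) (Some _)).
have [eg|eg] := boolP (idx e <= idx g); last first.
  exists g; rewrite -mulgA iota_idem //; split=> // x y /eP'.
  exact: letter_cancel.
(* Here [g] can be replaced by [u], which lies in the component of [e]. *)
set u := g * e * g; exists u.
have -> : s * iota g = s * iota u.
  by rewrite -se -!mulgA iota_mul_below.
rewrite -mulgA iota_idem; split=> // x y /eP' exy.
have eu : idx e = idx u by rewrite idx_sandwich.
by rewrite -(iota_cancel eu) mul1rM exy -mul1rM.
Qed.

End Head.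

(** * Collapsing components and abundance *)

Definition collapsing (r : Y) : Prop :=
  [\/ left_zero_on (fun x => idx x = r), right_zero_on (fun x => idx x = r)
    | exists2 c, idx c = r &
        forall h v, r < idx h -> idx v = r -> h * v * h = c].

(** After rewriting [h v] as [(h v h) v], the middle letter is absorbed by [c] (left zero), by [v]
    (right zero), or equals [c]. *)
Lemma collapsing_absorb r : (exists x, idx x = r) -> collapsing r ->
  exists c, idx c = r /\ forall h v, r < idx h -> idx v = r ->
    iota c * iota h * iota v = iota c * iota v.
Proof.
case=> x xr [lz|rz|[c cr cP]]; [exists x|exists x|exists c]; split=> // h v rh vr;
  have vh : idx v <= idx h by rewrite vr ltW.
all: rewrite -mulgA [iota h * _]iota_mul_above //.
- have xu : x * (h * v * h) = x by apply: lz; rewrite ?idx_sandwich.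
  by rewrite mulgA [iota x * iota (h * v * h)](iotaM IGS) ?xu //; exists x; auto.
- have uv : h * v * h * v = v by apply: rz; rewrite ?idx_sandwich.
  by congr (_ * _); rewrite [_ * iota v](iotaM IGS) ?uv //; exists v; auto.
- by rewrite cP // mulgA iota_idem.
Qed.

Hypothesis idx_surj : forall r, exists x, idx x = r.
Hypothesis all_collapsing : forall r, collapsing r.

Lemma free_ig_Lstar (s : S) : exists2 e, e * e = e & Lstar s e.
Proof.
have [head [head1 headM]] := head_exists.
have [c cP] := choice (fun r => collapsing_absorb (idx_surj r) (all_collapsing r)).
have [e [se eP]] := last_letter head1 headM
  (fun r => proj1 (cP r)) (fun r => proj2 (cP r)) s.
exists (iota e); first exact: iota_idem.
move=> x y; split=> [|exy]; first exact: eP.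
by rewrite -se !mul1rM exy.
Qed.

End FreeIGOverBand.
End NormalBand.

Lemma free_ig_Rstar (B : semigroupType) (d : Order.disp_t)
    (Y : meetSemilatticeType d) (idx : B -> Y)
    (S : semigroupType) (iota : B -> S) :
  normal_band B -> (forall x y, idx (x * y) = idx x `&` idx y) ->
  (forall x y, idx x = idx y -> x * y * x = x) -> free_ig iota ->
  (forall r, exists x, idx x = r) -> (forall r, collapsing idx r) ->
  forall s : S, exists2 e, e * e = e & Rstar s e.
Proof.
case=> mulxx normal idxM rect IGS surj coll.
apply: (@free_ig_Lstar (opposite B) d Y idx _ _ _ _ (opposite S) iota) => //.
- by move=> x y; rewrite meetC -idxM.
- by move=> x y xy; rewrite -[RHS](rect x y xy) -mulgA.
- suff h (x y z : B) : x * (z * (y * x)) = x * (y * (z * x)) by exact: h.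
  by rewrite !mulgA normal.
- exact: free_ig_opposite.
(* Passing to the opposite swaps left and right zero; the third alternative is self-dual. *)
- move=> r; case: (coll r) => [lz|rz|[c cr cP]].
  + by apply: Or32 => x y xr yr; apply: lz.
  + by apply: Or31 => x y xr yr; apply: rz.
  + by apply: Or33; exists c => // h v rh vr; rewrite -(cP h v) // -mulgA.
Qed.

(** * The presentation has the universal property *)

Lemma word_inj (X : Type) : injective (@word X).
Proof. by case=> [u u0] [v v0] /= uv; subst v; rewrite (bool_irrelevance u0 v0). Qed.

Definition IG_letter (B : semigroupType) (e : B) : IG B :=
  \pi_(quotient_semigroup (@IG_relation B)) (letter e).

Lemma IG_free_ig (B : semigroupType) : free_ig (@IG_letter B).
Proof.
have piM (u v : free_semigroup B) :
    \pi_(IG B) u * \pi_(IG B) v = \pi_(IG B) (u * v) :> IG B.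
  exact: quotient_mulE.
split=> [e f ef|P P1 PM s|T m j mA jM].
- by rewrite piM; apply/quotient_piP/cc_base; exists e, f.
- rewrite -[s]reprK; case: (repr s) => [[|e w] // we].
  elim: w e we => [|f w IH] e we.
    have -> : FreeSemigroup we = letter e by apply: word_inj.
    exact: P1.
  have -> : FreeSemigroup we = letter e * @FreeSemigroup _ (f :: w) isT.
    exact: word_inj.
  by rewrite -piM; apply: PM (P1 e) (IH f isT).
(* The fold starts at the first letter, as [T] need not have a unit. *)
pose J e (w : seq B) := foldl (fun t f => m t (j f)) (j e) w.
have JM e w f w' : J e (w ++ f :: w') = m (J e w) (J f w').
  rewrite /J foldl_cat /=; move: (foldl _ (j e) w) (j f) => t t'.
  by elim: w' t' => //= g w' IH t'; rewrite -mA IH.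
pose G (u : free_semigroup B) : T :=
  let: FreeSemigroup w w0 := u in
  match w return ~~ nilp w -> T with
  | [::] => fun w0 => False_rect T (notF w0)
  | e :: w' => fun _ => J e w'
  end w0.
have GM u v : G (u * v) = m (G u) (G v).
  by case: u v => [[|e w] // we] [[|f w'] // wf]; apply: JM.
have Gcc u v : congruence_closure (@IG_relation B) u v -> G u = G v.
  elim=> {u v} // [u v [e [f [ef -> ->]]] | u v w _ -> _ -> //| u u' v v' _ uu' _ vv'].
    exact: jM.
  by rewrite !GM uu' vv'.
exists (fun s => G (repr s)); split=> [e | s t].
  by rewrite -[RHS]/(G (letter e)); apply/Gcc/quotient_piP; rewrite reprK.
rewrite -GM; apply/Gcc/quotient_piP; rewrite reprK -quotient_mulE !reprK.
by [].
Qed.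

(** * Strong semilattices: the Y-basic and pliant cases *)

Lemma IG_abundant (B : semigroupType) (d : Order.disp_t)
    (Y : meetSemilatticeType d) (D : strong_semilattice B Y) :
  normal_band B -> (forall r, collapsing (ss_index D) r) -> abundant (IG B).
Proof.
move=> nB coll.
have idxM x y : ss_index D (x * y) = ss_index D x `&` ss_index D y.
  have [DM _ _] := ss_rectangular D (ss_index D x `&` ss_index D y).
  rewrite (@ss_mul _ _ _ D (ss_index D x) (ss_index D y)) //.
  by apply: DM; apply: ss_map_component; rewrite ?leIl ?leIr.
have rect x y : ss_index D x = ss_index D y -> x * y * x = x.
  by have [_ _ h] := ss_rectangular D (ss_index D y) => xy; apply: h.
move=> s; split.
  case: (nB) => mulxx normal.
  exact: (free_ig_Lstar mulxx idxM rect normal (IG_free_ig B) (ss_nonempty D) coll).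
exact: (free_ig_Rstar nB idxM rect (IG_free_ig B) (ss_nonempty D) coll).
Qed.

(** Both outer factors become the image of [h], and rectangularity removes [v]. For pliant bands
    this yields the third alternative of [collapsing]. *)
Lemma ss_sandwich (B : semigroupType) (d : Order.disp_t)
    (Y : meetSemilatticeType d) (D : strong_semilattice B Y) (a b : Y) (h v : B) :
  a <= b -> ss_component D b h -> ss_component D a v ->
  h * v * h = ss_map D b a h.
Proof.
move=> ab bh av; have ah := ss_map_component ab bh.
have [DM _ rect] := ss_rectangular D a.
rewrite (ss_mul bh av) (meet_r ab) (ss_map_id av).
have ahv := DM _ _ ah av.
by rewrite (ss_mul ahv bh) (meet_l ab) (ss_map_id ahv) rect.
Qed.

Theorem theorem7p6 (B : semigroupType) :
  normal_band B -> Y_basic B \/ pliant B -> abundant (IG B).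
Proof.
move=> nB [[d [Y [D basic]]] | [d [Y [D plD]]]]; apply: (IG_abundant (D := D)) => // a.
  by case: (basic a) => ?; [apply: Or31 | apply: Or32].
apply: Or33; have [c ac cP] := plD a; exists c => // h v ah av.
by rewrite (ss_sandwich (ltW ah) (erefl (ss_index D h)) av) cP.
Qed.
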